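(* Let $(X,Y,A,f,h)$ satisfy the standing assumptions in the context. Let $\alpha_k\in[0,1]$, $k=0,1,2,\dots$, and let $(x_k,u_k,s_k)$, $k=0,1,2,\dots$, be the iterates generated by the generalized conditional subgradient algorithm for $\min_{x\in X}\{f(Ax)+h(x)\}$ (defined in the context) with step sizes $\alpha_k$. If $\alpha_0=1$, then for all $k=1,2,\dots$ $$\sum_{i=0}^{k-1}\lambda_i^k\bigl(f^*(u_i)+h^*(-A^*u_i)\bigr)-\sum_{i=0}^{k-1}\mu_i^k\,\mathcal{D}_{f\circ A,h}(x_i,s_i,\alpha_i)=-f(Ax_k)-h(x_k).$$
   Context: Setting. $X,Y$ are finite-dimensional real vector spaces with duals $X^*,Y^*$ and pairings $\langle\cdot,\cdot\rangle$; $A:X\to Y$ is linear with adjoint $A^*:Y^*\to X^*$; $f:Y\to\mathbb{R}\cup\{\infty\}$ and $h:X\to\mathbb{R}\cup\{\infty\}$ are proper closed convex functions with Fenchel conjugates $f^*:Y^*\to\mathbb{R}\cup\{\infty\}$, $h^*:X^*\to\mathbb{R}\cup\{\infty\}$. $\operatorname{dom}(\partial f)\subseteq Y$ and $\operatorname{dom}(\partial h^* )\subseteq X^*$ are the sets of points at which the respective subdifferential is nonempty. Single-valued oracles are fixed: for each $y\in\operatorname{dom}(\partial f)$, $\partial f(y)\in Y^*$ denotes one fixed chosen element of $\operatorname{argmax}_{v\in Y^*}\{\langle v,y\rangle-f^*(v)\}$ (the subdifferential of $f$ at $y$); for each $u\in\operatorname{dom}(\partial h^* )$, $\partial h^*(u)\in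 X$ denotes one fixed chosen element of $\operatorname{argmax}_{x\in X}\{\langle u,x\rangle-h(x)\}$ (the subdifferential of $h^*$ at $u$). Standing assumption: $-A^*\partial f(y)\in\operatorname{dom}(\partial h^* )$ for all $y\in\operatorname{dom}(\partial f)$, and $A\,\partial h^*(u)\in\operatorname{dom}(\partial f)$ for all $u\in\operatorname{dom}(\partial h^* )$. Generalized Bregman distance: $D_f(y,w)=f(y)-f(w)-\langle\partial f(w),y-w\rangle$ for $w\in\operatorname{dom}(\partial f)$, $y\in\operatorname{dom}(f)$, with the chosen subgradient; $D_{f\circ A}(x',x):=D_f(Ax',Ax)$. Notation: $\mathcal{D}_{f\circ A,h}(x,s,\alpha):=D_{f\circ A}((1-\alpha)x+\alpha s,x)+h((1-\alpha)x+\alpha s)-(1-\alpha)h(x)-\alpha h(s)$, with the convention $0\cdot\infty=0$ (relevant only for $i=0$, $\alpha_0=1$). Generalized conditional subgradient algorithm: given $x_0\in X$ with $Ax_0\in\operatorname{dom}(\partial f)$, for $k=0,1,2,\dots$: $u_k:=\partial f(Ax_k)$, $s_k:=\partial h^*(-A^*u_k)$, $x_{k+1}:=(1-\alpha_k)x_k+\alpha_ks_k$, where $\alpha_k\in[0,1]$. The iterates are understood to be well defined, i.e. $Ax_k\in\operatorname{dom}(\partial f)$ for all $k$. Weights: for $k=0,1,2,\dots$, $\lambda^{k+1}_k=\alpha_k$, $\mu^{k+1}_k=1$, and $\lambda^{k+1}_i=(1-\alpha_k)\lambda^k_i$, $\mu^{k+1}_i=(1-\alpha_k)\mu^k_i$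 for $i=0,\dots,k-1$. *)

(* Defs.v *)
From HB Require Import structures.
From mathcomp Require Import all_boot all_order all_algebra.
From mathcomp Require Import all_classical all_reals all_analysis.

Set Implicit Arguments.
Unset Strict Implicit.
Unset Printing Implicit Defensive.

Import Order.TTheory GRing.Theory Num.Theory.
Import numFieldNormedType.Exports.

Local Open Scope classical_set_scope.
Local Open Scope ring_scope.

(* A finite-dimensional real vector space is a [vectType R] with [R : realType].
   The pairing of [u : dual_space V] with [x : V] is the application [u x].
   Functions with values in R \cup {oo} are maps to [\bar R] that never take the
   value -oo. *)

Definition dual_space (R : realType) (V : vectType R) : vectType R :=
  'Hom(V, R^o).

Definition adjoint (R : realType) (X Y : vectType R) (A : 'Hom(X, Y))
  (v : dual_space Y) : dual_space X := (v \o A)%VF.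

Section convex_analysis.
Context {R : realType} {V : vectType R}.
Implicit Types (f : V -> \bar R) (x y w : V) (v u : dual_space V).
Local Open Scope ereal_scope.

Definition proper_fun f := (forall y, f y != -oo) /\ (exists y, f y != +oo).

(* Closed means lower semicontinuous. A [vectType] carries no topology, so
   continuity is read in the coordinates of a basis; the resulting topology on
   V does not depend on the basis. *)
Definition closed_fun f := lower_semicontinuous (f \o passmx.vecof (vbasis {:V})).

(* At the endpoints of [0, 1] this relies on 0 * +oo = 0, which holds in
   [\bar R]; -oo + +oo does not occur when f is proper. *)
Definition convex_fun f := forall x y (t : R), (0 <= t <= 1)%R ->
  f ((1 - t) *: x + t *: y)%R <= (1 - t)%R%:E * f x + t%:E * f y.

Definition conjugate f v : \bar R := ereal_sup [set (v y)%:E - f y | y in setT].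

Definition argmax (T : Type) (g : T -> \bar R) : set T :=
  [set a | forall b, g b <= g a].

Definition subdiff f y : set (dual_space V) :=
  argmax (fun v : dual_space V => (v y)%:E - conjugate f v).

(* The subdifferential of the conjugate of f, as a subset of V itself rather
   than of its bidual. *)
Definition subdiff_conjugate f u : set V :=
  argmax (fun x : V => (u x)%:E - f x).

Definition dom_subdiff f : set V := [set y | subdiff f y !=set0].

Definition dom_subdiff_conjugate f : set (dual_space V) :=
  [set u | subdiff_conjugate f u !=set0].

(* [df w] is the subgradient chosen at w; it is meaningful only for w in
   [dom_subdiff f]. *)
Definition bregman f (df : V -> dual_space V) y w : \bar R :=
  f y - f w - (df w (y - w)%R)%:E.

End convex_analysis.

Section conditional_subgradient.
Context {R : realType} {X Y : vectType R}.
Variables (A : 'Hom(X, Y)) (f : Y -> \bar R) (h : X -> \bar R).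
Variables (df : Y -> dual_space Y) (dhs : dual_space X -> X).

Definition bregman_comp (x' x : X) : \bar R := bregman f df (A x') (A x).

(* [\bar R] has 0 * +oo = 0, so (1 - a) h x vanishes at a = 1 even when
   h x = +oo. *)
Definition calD (x s : X) (a : R) : \bar R :=
  (bregman_comp ((1 - a) *: x + a *: s)%R x
   + h ((1 - a) *: x + a *: s)%R - (1 - a)%R%:E * h x - a%:E * h s)%E.

Definition gcs_iterates (alpha : nat -> R)
    (x : nat -> X) (u : nat -> dual_space Y) (s : nat -> X) : Prop :=
  (forall k, dom_subdiff f (A (x k))) /\
  (forall k, [/\ u k = df (A (x k)),
                 s k = dhs (- adjoint A (u k)) &
                 x k.+1 = (1 - alpha k) *: x k + alpha k *: s k]).

End conditional_subgradient.

(* [lambda_weight alpha k i] and [mu_weight alpha k i] carry the upper index k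
   first; only the values at i < k are meaningful. *)
Fixpoint lambda_weight (R : realType) (alpha : nat -> R) (k i : nat) : R :=
  if k is j.+1 then
    if i == j then alpha j else (1 - alpha j) * lambda_weight alpha j i
  else 0.

Fixpoint mu_weight (R : realType) (alpha : nat -> R) (k i : nat) : R :=
  if k is j.+1 then
    if i == j then 1 else (1 - alpha j) * mu_weight alpha j i
  else 0.

(* Main.v *)
(** The chosen subgradients turn the Fenchel-Young inequality into equalities:
    f*(u_i) = <u_i, A x_i> - f(A x_i) and h*(-A* u_i) = -<u_i, A s_i> - h(s_i).
    With E_i = f(A x_i) + h(x_i) and p_i = f*(u_i) + h*(-A* u_i) they give
    D_i = E_(i+1) - (1 - alpha_i) E_i + alpha_i p_i for the i-th Bregman term,
    and the weighted sums telescope; alpha_0 = 1 removes E_0, which may be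
    infinite.
    Since the subdifferential of f at y is defined by maximising
    <v, y> - f*(v), the first equality needs f** = f.  This follows by projecting
    a point (x0, c) with c < f(x0) on the epigraph of f: the residual of the
    projection is the normal of a hyperplane, which yields an affine minorant of
    f exceeding c at x0. *)
Require Import Defs.
From HB Require Import structures.
From mathcomp Require Import all_boot all_order all_algebra.
From mathcomp Require Import all_classical all_reals all_analysis.
From mathcomp Require Import ring lra.

Set Implicit Arguments.
Unset Strict Implicit.
Unset Printing Implicit Defensive.

Import Order.TTheory GRing.Theory Num.Theory.
Import numFieldNormedType.Exports passmx.

Local Open Scope classical_set_scope.
Local Open Scope ring_scope.

(** * Euclidean inner product of row vectors *)

Definition dot (R : realType) (n : nat) (v w : 'rV[R]_n) : R :=
  \sum_i v 0 i * w 0 i.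

Lemma dotDr (R : realType) n (v w w' : 'rV[R]_n) :
  dot v (w + w') = dot v w + dot v w'.
Proof. by rewrite -big_split; apply: eq_bigr => i _; rewrite !mxE mulrDr. Qed.

Lemma dotZr (R : realType) n (v w : 'rV[R]_n) (a : R) :
  dot v (a *: w) = a * dot v w.
Proof.
by rewrite mulr_sumr; apply: eq_bigr => i _; rewrite mxE mulrCA.
Qed.

Lemma dotC (R : realType) n (v w : 'rV[R]_n) : dot v w = dot w v.
Proof. by apply: eq_bigr => i _; rewrite mulrC. Qed.

Lemma dotNr (R : realType) n (v w : 'rV[R]_n) : dot v (- w) = - dot v w.
Proof. by rewrite -scaleN1r dotZr mulN1r. Qed.

Lemma dotBr (R : realType) n (v w w' : 'rV[R]_n) :
  dot v (w - w') = dot v w - dot v w'.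
Proof. by rewrite dotDr dotNr. Qed.

Lemma dotZl (R : realType) n (v w : 'rV[R]_n) (a : R) :
  dot (a *: v) w = a * dot v w.
Proof. by rewrite dotC dotZr dotC. Qed.

Lemma dotDl (R : realType) n (v v' w : 'rV[R]_n) :
  dot (v + v') w = dot v w + dot v' w.
Proof. by rewrite ![dot _ w]dotC dotDr. Qed.

Lemma sqr_coord_le_dot (R : realType) n (v : 'rV[R]_n) i :
  v 0 i ^+ 2 <= dot v v.
Proof.
rewrite /dot (bigD1 i)//= -expr2 lerDl sumr_ge0// => j _.
by rewrite -expr2 sqr_ge0.
Qed.

Lemma dot_ge0 (R : realType) n (v : 'rV[R]_n) : 0 <= dot v v.
Proof. by rewrite sumr_ge0// => j _; rewrite -expr2 sqr_ge0. Qed.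

Lemma dot_le0_eq0 (R : realType) n (v : 'rV[R]_n) : dot v v <= 0 -> v = 0.
Proof.
move=> v0; apply/rowP => i; rewrite mxE; apply/eqP; rewrite -sqrf_eq0.
by rewrite eq_le sqr_ge0 (le_trans (sqr_coord_le_dot _ i)).
Qed.

(** * Projection on a closed convex epigraph *)

Lemma continuous_dist2 (R : realType) n (x0 : 'rV[R]_n) (c : R) :
  continuous (fun z : 'rV[R]_n * R^o =>
    dot (z.1 - x0) (z.1 - x0) + (z.2 - c) ^+ 2 : R^o).
Proof.
move=> z; apply: cvgD.
  rewrite /dot; apply: cvg_big => [|i _]; first exact: add_continuous.
  have cvgi : (fun y : 'rV[R]_n * R^o => (y.1 - x0) 0 i : R^o) @ z
       --> ((z.1 - x0) 0 i : R^o).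
    under eq_fun do rewrite !mxE.
    rewrite !mxE; apply: cvgB; last exact: cvg_cst.
    apply: (@continuous_comp _ _ _ fst (fun y : 'rV[R]_n => y 0 i : R^o)).
      exact: cvg_fst.
    exact: coord_continuous.
  exact: cvgM.
have cvg2 : (fun y : 'rV[R]_n * R^o => y.2 - c : R^o) @ z --> (z.2 - c : R^o).
  by apply: cvgB; [exact: cvg_snd|exact: cvg_cst].
exact: cvgM.
Qed.

(** If r < F p, pick a real a strictly between: the neighbourhood {F > a} x {t < a} of (p, r) avoids
    the epigraph. *)
Lemma closed_epigraph (R : realType) (T : topologicalType) (F : T -> \bar R) :
  lower_semicontinuous F ->
  closed [set z : T * R^o | (F z.1 <= z.2%:E)%E].
Proof.
move=> Flsc; rewrite -[X in closed X]setCK; apply: open_closedC.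
rewrite openE => -[p r] /= /negP; rewrite -ltNge => /= rFp.
have [a ra aFp] : exists2 a : R, r < a & (a%:E < F p)%E.
  move: rFp; case: (F p) => [q| |//]; rewrite ?lte_fin.
    by move=> rq; exists ((r + q) / 2); rewrite ?lte_fin; lra.
  by move=> _; exists (r + 1); rewrite ?ltry//; lra.
have [V Vp VF] := Flsc _ _ aFp.
exists (V, [set t | t < a]) => /=.
  by split => //=; exact: (@lt_nbhsl R r a).
move=> [y t] [/= Vy ta]; apply/negP; rewrite -ltNge.
by apply: lt_trans (VF _ Vy); rewrite lte_fin.
Qed.

(** The squared distance to (x0, c) attains its minimum on the part of the epigraph in a compact
    box; outside the box it exceeds its value at a known epigraph point. *)
Lemma epigraph_nearest_point (R : realType) n (F : 'rV[R]_n -> \bar R) x0 (c : R) :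
  lower_semicontinuous F -> (exists y, F y != +oo)%E -> (forall y, F y != -oo)%E ->
  exists p (r : R), (F p <= r%:E)%E /\
    forall y (t : R), (F y <= t%:E)%E ->
      dot (p - x0) (p - x0) + (r - c) ^+ 2 <=
      dot (y - x0) (y - x0) + (t - c) ^+ 2.
Proof.
move=> Flsc [y0 Fy0] FNy.
have FyE : F y0 = (fine (F y0))%:E by rewrite fineK// fin_numE FNy.
pose d := fun z : 'rV[R]_n * R^o =>
  dot (z.1 - x0) (z.1 - x0) + (z.2 - c) ^+ 2 : R.
pose z0 : 'rV[R]_n * R^o := (y0, fine (F y0)).
(* Adding 1 makes M >= 1, so that (a - b)^2 <= M forces |a - b| <= M. *)
pose M := d z0 + 1.
have d_ge0 z : 0 <= d z by rewrite addr_ge0 ?dot_ge0 ?sqr_ge0.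
have M1 : 1 <= M by rewrite lerDr d_ge0.
pose K := [set z : 'rV[R]_n * R^o |
  (forall i, z.1 0 i \in `[x0 0 i - M, x0 0 i + M]) /\ z.2 \in `[c - M, c + M]].
have abs_le (a b : R) : (a - b) ^+ 2 <= M -> a \in `[b - M, b + M].
  move=> abM; rewrite in_itv/=; apply/andP; split; nra.
have dK z : d z <= M -> K z.
  move=> dz; split => [i|]; apply: abs_le; apply: le_trans dz.
    have := sqr_coord_le_dot (z.1 - x0) i; rewrite !mxE => /le_trans; apply.
    by rewrite /d lerDl sqr_ge0.
  by rewrite /d lerDr dot_ge0.
have compactK : compact K.
  have -> : K = [set v : 'rV[R]_n | forall i, `[x0 0 i - M, x0 0 i + M]%classic (v 0 i)]
      `*` [set` `[c - M, c + M]].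
    by apply/seteqP; split => -[v t].
  apply: compact_setX; last exact: segment_compact.
  apply: (@rV_compact R n (fun i => `[x0 0 i - M, x0 0 i + M]%classic)) => i.
  exact: segment_compact.
pose E := [set z : 'rV[R]_n * R^o | (F z.1 <= z.2%:E)%E].
have cE : closed E by exact: closed_epigraph.
have z0KE : (K `&` E) z0.
  split; first by apply: dK; rewrite /M; lra.
  by rewrite /E/= -FyE.
have [] := @compact_EVT_min _ _ d (K `&` E).
- by exists z0.
- exact: compact_closedI.
- by apply: continuous_subspaceT; exact: continuous_dist2.
move=> [p r]; rewrite inE => -[_ Epr] dmin; exists p, r; split => // y t Fyt.
have [dM|Md] := leP (d (y, t)) M.
  by apply: (dmin (y, t)); rewrite inE; split => //; exact: dK.
apply: le_trans (ltW Md); apply: (@le_trans _ _ (d z0)).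
  by apply: (dmin z0); rewrite inE.
by rewrite /M; lra.
Qed.

(** First-order condition at a minimum in t = 0: if a < 0, then t = -a / (b - a) lies in (0, 1] and
    makes the quadratic negative. *)
Lemma ge0_of_quadratic (R : realType) (a b : R) : 0 <= b ->
  (forall t, 0 < t <= 1 -> 0 <= t * (2 * a) + t ^+ 2 * b) -> 0 <= a.
Proof.
move=> b0 ab; rewrite leNgt; apply/negP => a0.
have ba0 : 0 < b - a by lra.
have ba_neq0 : b - a != 0 by rewrite gt_eqF.
have := ab (- a / (b - a)).
rewrite divr_gt0 ?oppr_gt0// ler_pdivrMr// mul1r lerDr b0 => /(_ isT).
have -> : - a / (b - a) * (2 * a) + (- a / (b - a)) ^+ 2 * b =
   - a ^+ 2 * ((b - 2 * a) / (b - a) ^+ 2) by field.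
have a2 : 0 < a ^+ 2 by nra.
rewrite mulNr oppr_ge0 leNgt mulr_gt0//.
by rewrite divr_gt0 ?exprn_gt0//; lra.
Qed.

(** Variational inequality of the projection (p, r) of (x0, c): by convexity the segment from (p, r)
    to (y, t) stays in the epigraph, so the distance along it never falls below its initial
    value. *)
Lemma epigraph_projection (R : realType) n (F : 'rV[R]_n -> \bar R) x0 (c : R) :
  proper_fun F -> lower_semicontinuous F -> convex_fun F ->
  exists p (r : R), (F p <= r%:E)%E /\
    forall y (t : R), (F y <= t%:E)%E ->
      dot (x0 - p) (y - p) <= (r - c) * (t - r).
Proof.
move=> [FNy Fy] Flsc Fconv.
have [p [r [Fpr prmin]]] := epigraph_nearest_point x0 c Flsc Fy FNy.
exists p, r; split => // y t Fyt.
rewrite -subr_ge0; set a := (X in 0 <= X).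
apply: (@ge0_of_quadratic _ _ (dot (y - p) (y - p) + (t - r) ^+ 2)).
  by rewrite addr_ge0 ?dot_ge0// sqr_ge0.
move=> th /andP[th0 th1].
have := prmin ((1 - th) *: p + th *: y) ((1 - th) * r + th * t).
have -> : (1 - th) *: p + th *: y - x0 = (p - x0) + th *: (y - p).
  by apply/rowP => i; rewrite !mxE; ring.
rewrite !(dotDl (p - x0)) !(dotDr _ (p - x0)) !dotZl !dotZr.
rewrite [dot (y - p) (p - x0)]dotC.
have -> : dot (p - x0) (y - p) = - dot (x0 - p) (y - p).
  by rewrite dotC -(opprB x0 p) dotNr dotC.
rewrite -subr_ge0 => main; suff /main :
    (F ((1 - th) *: p + th *: y)%R <= ((1 - th) * r + th * t)%:E)%E.
  by congr (0 <= _); rewrite /a; ring.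
apply: le_trans (Fconv p y th _) _; first by rewrite (ltW th0).
by rewrite (EFinD (_ * r)) !EFinM leeD// lee_wpmul2l// lee_fin; lra.
Qed.

(** * Affine minorants from supporting hyperplanes *)

Lemma affine_minorant_of_slope (R : realType) n (F : 'rV[R]_n -> \bar R)
    x0 p (c r : R) : (forall y, F y != -oo%E) -> c < r ->
  (forall y (t : R), (F y <= t%:E)%E ->
     dot (x0 - p) (y - p) <= (r - c) * (t - r)) ->
  exists w b, (forall y, (dot w y + b)%:E <= F y)%E /\ c < dot w x0 + b.
Proof.
move=> FNy cr Fpr; have rc0 : 0 < r - c by rewrite subr_gt0.
(* The normal (x0 - p, c - r) is rescaled so that its last coordinate is -1. *)
pose w := (r - c)^-1 *: (x0 - p).
have wE y : dot w y + (r - dot w p) = r + (r - c)^-1 * dot (x0 - p) (y - p).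
  by rewrite dotBr /w !dotZl; ring.
exists w, (r - dot w p); split => [y|]; rewrite wE.
  have := Fpr y; have := FNy y; case: (F y) => [t _ /(_ t (lexx _))||//].
    by rewrite lee_fin -lerBrDl ler_pdivrMl.
  by rewrite leey.
by rewrite (lt_le_trans cr)// lerDl mulr_ge0 ?dot_ge0// invr_ge0 ltW.
Qed.

(** The epigraph contains (p, r + 1), so the normal cannot point upwards. *)
Lemma epigraph_slope_ge0 (R : realType) n (F : 'rV[R]_n -> \bar R)
    x0 p (c r : R) : (F p <= r%:E)%E ->
  (forall y (t : R), (F y <= t%:E)%E ->
     dot (x0 - p) (y - p) <= (r - c) * (t - r)) -> c <= r.
Proof.
move=> Fp /(_ p (r + 1)); rewrite (le_trans Fp) ?lee_fin ?lerDl// => /(_ isT).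
by rewrite dotBr subrr addrAC subrr add0r mulr1 subr_ge0.
Qed.

(** Project (x0, F x0 - 1) with F x0 finite: a vertical hyperplane would force x0 = p, hence F x0 <=
    F x0 - 1. *)
Lemma affine_minorant_exists (R : realType) n (F : 'rV[R]_n -> \bar R) :
  proper_fun F -> lower_semicontinuous F -> convex_fun F ->
  exists w b, forall y, ((dot w y + b)%:E <= F y)%E.
Proof.
move=> Fp Flsc Fconv; have [FNy [x0 Fx0y]] := Fp.
have [c Fx0] : exists c, F x0 = c%:E.
  by move: (FNy x0) Fx0y; case: (F x0) => // c; exists c.
have [p [r [Fpr Fproj]]] := epigraph_projection x0 (c - 1) Fp Flsc Fconv.
have := epigraph_slope_ge0 Fpr Fproj; rewrite le_eqVlt => /orP[/eqP cr|cr].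
  have /dot_le0_eq0/eqP : dot (x0 - p) (x0 - p) <= 0.
    have := Fproj x0 c; rewrite Fx0 => /(_ (lexx _)).
    by rewrite -cr subrr mul0r.
  by rewrite subr_eq0 => /eqP x0p; move: Fpr; rewrite -x0p Fx0 lee_fin; lra.
by have [w [b [Fwb _]]] := affine_minorant_of_slope FNy cr Fproj; exists w, b.
Qed.

Lemma affine_minorant_gt (R : realType) n (F : 'rV[R]_n -> \bar R) x0 (c : R) :
  proper_fun F -> lower_semicontinuous F -> convex_fun F -> (c%:E < F x0)%E ->
  exists w b, (forall y, (dot w y + b)%:E <= F y)%E /\ c < dot w x0 + b.
Proof.
move=> Fp Flsc Fconv cFx0; have [FNy _] := Fp.
have [p [r [Fpr Fproj]]] := epigraph_projection x0 c Fp Flsc Fconv.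
have := epigraph_slope_ge0 Fpr Fproj; rewrite le_eqVlt => /orP[/eqP cr|cr];
  last exact: affine_minorant_of_slope Fproj.
(* The separating hyperplane is vertical: tilt a given affine minorant by a
   large multiple of it. *)
have [w0 [b0 Fwb0]] := affine_minorant_exists Fp Flsc Fconv.
pose d := x0 - p.
have dd0 : 0 < dot d d.
  rewrite ltNge; apply/negP => /dot_le0_eq0/eqP; rewrite subr_eq0 => /eqP x0p.
  by move: Fpr; rewrite leNgt -cr -x0p cFx0.
(* With this [N] the tilt raises the minorant at x0 by |c - (<w0, x0> + b0)| + 1, enough to exceed
   c. *)
pose N := (`|c - (dot w0 x0 + b0)| + 1) / dot d d.
have N0 : 0 <= N by rewrite divr_ge0 ?ltW// addr_ge0.
have wE y : dot (w0 + N *: d) y + (b0 - N * dot d p) =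
    dot w0 y + b0 + N * dot d (y - p).
  by rewrite dotDl dotZl dotBr; ring.
exists (w0 + N *: d), (b0 - N * dot d p); split => [y|]; rewrite wE; last first.
  rewrite -ltrBlDl divfK ?gt_eqF//.
  by rewrite (le_lt_trans (ler_norm _))// ltrDl.
(* Where F is finite, the projection inequality with r = c gives <d, y - p> <= 0, so the tilt only
   lowers the minorant. *)
have := Fproj y; have := Fwb0 y; have := FNy y; rewrite -cr subrr.
case: (F y) => [t _|_ _ _|//]; last by rewrite leey.
rewrite !lee_fin => Ft /(_ t (lexx _)); rewrite mul0r => dyp.
by rewrite (le_trans _ Ft)// gerDl mulr_ge0_le0.
Qed.

(** * Transfer from coordinates to an abstract space *)

Lemma proper_vecof (R : realType) (V : vectType R) (f : V -> \bar R) :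
  proper_fun f -> proper_fun (f \o vecof (vbasis {:V})).
Proof.
move=> [fNy [y fy]]; split => [z|]; first exact: fNy.
by exists (rVof (vbasis {:V}) y); rewrite /= rVofK ?vbasisP.
Qed.

Lemma convex_vecof (R : realType) (V : vectType R) (f : V -> \bar R) :
  convex_fun f -> convex_fun (f \o vecof (vbasis {:V})).
Proof.
by move=> fconv x y t t01; rewrite /= linearD !linearZ; exact: fconv.
Qed.

Lemma dual_minorant_gt (R : realType) (V : vectType R) (f : V -> \bar R) y (c : R) :
  proper_fun f -> closed_fun f -> convex_fun f -> (c%:E < f y)%E ->
  exists (v : dual_space V) (b : R),
    (forall z, (v z + b)%:E <= f z)%E /\ c < v y + b.
Proof.
move=> fp fc fconv cfy; set e := vbasis {:V}.
have rK z : vecof e (rVof e z) = z.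
  by rewrite rVofK ?vbasisP.
have [|w [b [Fwb cwb]]] := @affine_minorant_gt R _ (f \o vecof e)
    (rVof e y) c (proper_vecof fp) fc (convex_vecof fconv).
  by rewrite /= rK.
pose g z : R^o := dot w (rVof e z).
have glin : linear g.
  by move=> a z z'; rewrite /g linearP dotDr dotZr.
pose gL : {linear V -> R^o} := HB.pack g (GRing.isLinear.Build _ _ _ _ g glin).
exists (linfun gL), b; split => [z|]; rewrite lfunE/= //.
by have := Fwb (rVof e z); rewrite /= rK.
Qed.

(** * Equality in the Fenchel-Young inequality *)

Lemma conjugate_ub (R : realType) (V : vectType R) (f : V -> \bar R)
    (v : dual_space V) z : ((v z)%:E - f z <= conjugate f v)%E.
Proof. by apply: ereal_sup_ubound; exists z. Qed.

Lemma conjugate_neqNy (R : realType) (V : vectType R) (f : V -> \bar R)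
    (v : dual_space V) : proper_fun f -> conjugate f v != -oo%E.
Proof.
move=> [fNy [z fz]]; rewrite -ltNye; apply: lt_le_trans (conjugate_ub f v z).
by move: (fNy z) fz; case: (f z) => [r _ _||]//; rewrite ltNyr.
Qed.

(** An affine minorant <w, z> + b exceeding c at y gives f*(w) <= -b, so c < <w, y> - f*(w), and v
    maximises this bound. Hence f(y) <= <v, y> - f*(v); the converse is Fenchel-Young. *)
Lemma subdiffE (R : realType) (V : vectType R) (f : V -> \bar R) y
    (v : dual_space V) : proper_fun f -> closed_fun f -> convex_fun f ->
  subdiff f y v ->
  exists a b : R, [/\ f y = a%:E, conjugate f v = b%:E & a + b = v y].
Proof.
move=> fp fc fconv fyv; have [fNy _] := fp.
have minorant_lt (c : R) : (c%:E < f y)%E ->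
    (c%:E < (v y)%:E - conjugate f v)%E.
  move=> /(dual_minorant_gt fp fc fconv)[w [b [fwb cwb]]].
  apply: lt_le_trans (fyv w).
  have fw : (conjugate f w <= (- b)%:E)%E.
    apply: ge_ereal_sup => _ [z _ <-]; move: (fwb z).
    case: (f z) => [t| |]; rewrite ?leeNy_eq ?leNye// -EFinB !lee_fin; lra.
  apply: lt_le_trans (leeB (lexx _) fw).
  by rewrite -EFinB opprK lte_fin.
have := conjugate_ub f v y; have := conjugate_neqNy v fp; have := fNy y.
move: minorant_lt; case: (f y) => [a| |//]; case: (conjugate f v) => [b| |//].
- move=> minorant_lt _ _; rewrite -EFinB lee_fin => vab.
  exists a, b; split => //; apply/eqP; rewrite eq_le; apply/andP; split.
    rewrite leNgt; apply/negP => vab'.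
    suff /minorant_lt : ((v y - b)%:E < a%:E)%E by rewrite -EFinB ltxx.
    by rewrite lte_fin; lra.
  by rewrite addrC; lra.
(* In the infinite cases a suitable c contradicts [minorant_lt]: the bound is -oo, or c itself. *)
- by move=> /(_ (a - 1)); rewrite lte_fin ltrBlDr ltrDl ltr01 => /(_ isT).
- by move=> /(_ (v y - b)); rewrite -EFinB ltxx ltry => /(_ isT).
- by move=> /(_ 0); rewrite ltry => /(_ isT).
Qed.

(** A maximiser x is a point where the supremum h*(u) is attained; since h*(u) is not -oo, h(x) is
    finite. *)
Lemma subdiff_conjugateE (R : realType) (V : vectType R) (h : V -> \bar R)
    (u : dual_space V) x : proper_fun h -> subdiff_conjugate h u x ->
  exists a b : R, [/\ h x = a%:E, conjugate h u = b%:E & a + b = u x].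
Proof.
move=> hp hux; have [hNy [z hz]] := hp.
have hE : conjugate h u = ((u x)%:E - h x)%E.
  apply/le_anti; rewrite conjugate_ub andbT.
  by apply: ge_ereal_sup => _ [z' _ <-]; exact: hux.
have := hNy x; have := conjugate_neqNy u hp; rewrite hE.
case: (h x) => [a _ _|//|//].
by exists a, (u x - a); rewrite EFinB; split => //; ring.
Qed.

(** * Weighted sums and Bregman terms *)

Lemma sum_lambda_weightS (R : realType) (alpha p : nat -> R) k :
  \sum_(0 <= i < k.+1) lambda_weight alpha k.+1 i * p i =
  (1 - alpha k) * (\sum_(0 <= i < k) lambda_weight alpha k i * p i) +
  alpha k * p k.
Proof.
rewrite big_nat_recr//= eqxx mulr_sumr; congr (_ + _).
by apply: eq_big_nat => i /andP[_ ik]; rewrite ltn_eqF// mulrA.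
Qed.

Lemma sum_mu_weightS (R : realType) (alpha d : nat -> R) k :
  \sum_(0 <= i < k.+1) mu_weight alpha k.+1 i * d i =
  (1 - alpha k) * (\sum_(0 <= i < k) mu_weight alpha k i * d i) + d k.
Proof.
rewrite big_nat_recr//= eqxx mulr_sumr mul1r; congr (_ + _).
by apply: eq_big_nat => i /andP[_ ik]; rewrite ltn_eqF// mulrA.
Qed.

(** The difference S_k of the two sums satisfies S_(k+1) = (1 - alpha_k) (S_k + E_k) - E_(k+1), so
    S_k = -E_k propagates; it starts at k = 1 because 1 - alpha_0 = 0. *)
Lemma weighted_sum_telescope (R : realType) (alpha p d E : nat -> R) k :
  alpha 0%N = 1 ->
  (forall i, d i = E i.+1 - (1 - alpha i) * E i + alpha i * p i) ->
  \sum_(0 <= i < k.+1) lambda_weight alpha k.+1 i * p i -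
  \sum_(0 <= i < k.+1) mu_weight alpha k.+1 i * d i = - E k.+1.
Proof.
move=> alpha0 dE; elim: k => [|k IHk]; rewrite sum_lambda_weightS sum_mu_weightS dE.
  by rewrite alpha0; ring.
rewrite opprD addrACA -mulrBr IHk; ring.
Qed.

(** [fine (h x)] may stand for h x even when h x is infinite: then a = 1 and both products
    vanish. *)
Lemma calD_fin (R : realType) (X Y : vectType R) (A : 'Hom(X, Y))
    (f : Y -> \bar R) (h : X -> \bar R) (df : Y -> dual_space Y)
    (x s x' : X) (a F F' H' hs : R) :
  x' = (1 - a) *: x + a *: s -> (a = 1 \/ h x \is a fin_num) ->
  f (A x) = F%:E -> f (A x') = F'%:E -> h x' = H'%:E -> h s = hs%:E ->
  calD A f h df x s a =
  (F' - F - a * (df (A x) (A s) - df (A x) (A x)) + H' -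
    (1 - a) * fine (h x) - a * hs)%:E.
Proof.
move=> x'E ahx fF fF' hH' hhs.
rewrite /calD /bregman_comp /bregman -x'E fF fF' hH' hhs.
have -> : ((1 - a)%:E * h x)%E = ((1 - a) * fine (h x))%:E.
  by case: ahx => [->|hx]; [rewrite subrr mul0e mul0r|rewrite EFinM fineK].
rewrite -!EFinM -!EFinD; congr (_%:E).
have -> : A x' - A x = a *: (A s - A x).
  rewrite x'E linearD !linearZ/= scalerBl scale1r scalerBr.
  by rewrite addrAC [A x - _]addrC addrK addrC.
by rewrite linearZ/= linearB.
Qed.

Theorem proposition3 (R : realType) (X Y : vectType R) (A : 'Hom(X, Y))
  (f : Y -> \bar R) (h : X -> \bar R)
  (f_proper : proper_fun f) (f_closed : closed_fun f) (f_convex : convex_fun f)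
  (h_proper : proper_fun h) (h_closed : closed_fun h) (h_convex : convex_fun h)
  (df : Y -> dual_space Y) (dhs : dual_space X -> X)
  (df_oracle : forall y, dom_subdiff f y -> subdiff f y (df y))
  (dhs_oracle : forall v, dom_subdiff_conjugate h v ->
     subdiff_conjugate h v (dhs v))
  (df_dom : forall y, dom_subdiff f y ->
     dom_subdiff_conjugate h (- adjoint A (df y)))
  (dhs_dom : forall v, dom_subdiff_conjugate h v -> dom_subdiff f (A (dhs v)))
  (alpha : nat -> R) (alpha01 : forall k, 0 <= alpha k <= 1)
  (x : nat -> X) (u : nat -> dual_space Y) (s : nat -> X)
  (iterates : gcs_iterates A f df dhs alpha x u s)
  (alpha0 : alpha 0%N = 1) (k : nat) (k_ge1 : (1 <= k)%N) :
  (\sum_(0 <= i < k) (lambda_weight alpha k i)%:E *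
       (conjugate f (u i) + conjugate h (- adjoint A (u i)))
   - \sum_(0 <= i < k) (mu_weight alpha k i)%:E *
       calD A f h df (x i) (s i) (alpha i)
   = - f (A (x k)) - h (x k))%E.
Proof.
have [xdom] := iterates; move=> /all_and3[uE sE xE].
have fE i : exists a b : R,
    [/\ f (A (x i)) = a%:E, conjugate f (u i) = b%:E & a + b = u i (A (x i))].
  by apply: subdiffE => //; rewrite uE; exact: df_oracle.
have hE i : exists a b : R,
    [/\ h (s i) = a%:E, conjugate h (- adjoint A (u i)) = b%:E &
        a + b = - u i (A (s i))].
  have -> : - u i (A (s i)) = (- adjoint A (u i)) (s i).
    by rewrite opp_lfunE comp_lfunE.
  apply: subdiff_conjugateE => //; rewrite sE uE.
  by apply: dhs_oracle; exact: df_dom.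
(* [F], [Fs], [G], [Gs] are the real sequences f(A x_i), f*(u_i), h(s_i), h*(-A* u_i). *)
have [F {}fE] := choice fE; have [Fs {}fE] := choice fE.
have [G {}hE] := choice hE; have [Gs {}hE] := choice hE.
have hx_step i : alpha i = 1 \/ h (x i) \is a fin_num ->
    h (x i.+1) \is a fin_num.
  have [hNy _] := h_proper; have [hs _ _] := hE i => alpha_hx.
  rewrite fin_numE hNy -ltey xE (le_lt_trans (h_convex _ _ _ (alpha01 i)))//.
  rewrite hs; case: alpha_hx => [->|hx]; first by rewrite subrr mul0e add0e ltry.
  by rewrite -(fineK hx) -!EFinM -EFinD ltry.
(* Only h(x_0) may be infinite, and alpha_0 = 1 covers that index. *)
have alpha_hx i : alpha i = 1 \/ h (x i) \is a fin_num.
  by elim: i => [|i /hx_step]; [left|right].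
have hxS i : h (x i.+1) = (fine (h (x i.+1)))%:E.
  by rewrite fineK//; exact: hx_step.
case: k k_ge1 => // k _.
(* If h(x_0) = +oo, [fine] turns it into 0; this is harmless, as E_0 only occurs with the factor 1 -
   alpha_0 = 0. *)
pose E i := F i + fine (h (x i)).
have DE i : calD A f h df (x i) (s i) (alpha i) =
    (E i.+1 - (1 - alpha i) * E i + alpha i * (Fs i + Gs i))%:E.
  have [fxi fsi fei] := fE i; have [hsi gsi gei] := hE i.
  have [fxS _ _] := fE i.+1.
  rewrite (calD_fin df (xE i) (alpha_hx i) fxi fxS (hxS i) hsi) -uE; congr (_%:E).
  (* Once the conjugate values are eliminated, the pairings <u_i, A x_i> and <u_i, A s_i> cancel. *)
  have -> : Fs i = u i (A (x i)) - F i by rewrite -fei addrAC subrr add0r.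
  have -> : Gs i = - u i (A (s i)) - G i by rewrite -gei addrAC subrr add0r.
  by rewrite /E; ring.
rewrite (eq_bigr (fun i => (lambda_weight alpha k.+1 i * (Fs i + Gs i))%:E));
  last by move=> i _; have [_ -> _] := fE i; have [_ -> _] := hE i.
rewrite [X in (_ - X = _)%E](eq_bigr (fun i => (mu_weight alpha k.+1 i *
    (E i.+1 - (1 - alpha i) * E i + alpha i * (Fs i + Gs i)))%:E));
  last by move=> i _; rewrite DE.
rewrite !sumEFin -EFinB (weighted_sum_telescope (E := E))//.
by have [-> _ _] := fE k.+1; rewrite hxS -EFinN -EFinB /E opprD.
Qed.
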